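(* Let $q=2^e$ with $e>1$. Let $M=\mathrm{Sp}_2(q^2):2$ be the maximal subgroup of $\mathrm{Sp}_4(q)$ obtained by viewing $\mathbb{F}_{q^2}^2$ as the $4$-dimensional $\mathbb{F}_q$-space $\mathbb{F}_q^4$ (so that $\mathrm{Sp}_2(q^2)\le\mathrm{Sp}_4(q)$), extended by the field (Galois) automorphism of order $2$ of $\mathbb{F}_{q^2}$ over $\mathbb{F}_q$. Then $(\mathrm{Sp}_4(q),M)$ is not a strong Gelfand pair.
   Context: All characters are complex. A pair $(G,H)$ with $H\le G$ finite is a strong Gelfand pair if for every irreducible character $\psi$ of $H$, the induced character $\psi\uparrow G$ satisfies $\langle \psi\uparrow G,\chi\rangle\le 1$ for every irreducible character $\chi$ of $G$. $\mathrm{Sp}_4(q)$ is the symplectic group of a nondegenerate alternating form on $\mathbb{F}_q^4$. *)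

(* Defs.v *)
From HB Require Import structures.
From mathcomp Require Import all_boot all_order all_algebra all_fingroup all_solvable all_field all_character.
Set Implicit Arguments. Unset Strict Implicit. Unset Printing Implicit Defensive.
Import Order.TTheory GRing.Theory Num.Theory.
Local Open Scope ring_scope.

Definition strong_Gelfand (gT : finGroupType) (G H : {group gT}) : Prop :=
  forall (i : Iirr H) (j : Iirr G), '['Ind[G, H] 'chi[H]_i, 'chi[G]_j] <= 1.

Section Sp4.
Variables (L : finFieldType) (e : nat).
(* q = 2^e; L is meant to be F_{q^2}, K = {x | x^q = x} is F_q. *)
Definition qq : nat := (2 ^ e)%N.
Definition in_K (c : L) : bool := c ^+ qq == c.
Definition vadd (u v : L * L) : L * L := (u.1 + v.1, u.2 + v.2).
Definition vscale (c : L) (u : L * L) : L * L := (c * u.1, c * u.2).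
Definition beta (u v : L * L) : L := u.1 * v.2 - u.2 * v.1.
Definition trLK (x : L) : L := x + x ^+ qq.
(* the alternating K-bilinear form on L^2 viewed as a 4-dim K-space *)
Definition Bform (u v : L * L) : L := trLK (beta u v).

Definition Sp4_set : {set {perm L * L}} :=
  [set g : {perm L * L} | [forall u, forall v, forall c : L,
     [&& g (vadd u v) == vadd (g u) (g v),
         in_K c ==> (g (vscale c u) == vscale c (g u)) &
         Bform (g u) (g v) == Bform u v]]].

Definition Sp2_set : {set {perm L * L}} :=
  [set g : {perm L * L} | [forall u, forall v, forall c : L,
     [&& g (vadd u v) == vadd (g u) (g v),
         g (vscale c u) == vscale c (g u) &
         beta (g u) (g v) == beta u v]]].

Definition frob_set : {set {perm L * L}} :=
  [set g : {perm L * L} | [forall u, g u == (u.1 ^+ qq, u.2 ^+ qq)]].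

Definition SpG : {group {perm L * L}} := [group of <<Sp4_set>>%g].
Definition MG : {group {perm L * L}} := [group of <<Sp2_set :|: frob_set>>%g].
End Sp4.

(* Main.v *)
Require Import Defs.
From HB Require Import structures.
From mathcomp Require Import all_boot all_order all_algebra all_fingroup all_solvable all_field all_character.
From mathcomp Require Import ring zify.
Set Implicit Arguments. Unset Strict Implicit. Unset Printing Implicit Defensive.
Import Order.TTheory GRing.Theory Num.Theory GroupScope.
Local Open Scope ring_scope.

(** Let [B] be the stabilizer in [Sp4(q)] of the flag [F_q u < F_(q^2) u] with
    [u = (1, 0)], let [C] be the upper triangular Borel subgroup of [Sp2(q^2)], and
    let [mu] be a faithful character of the multiplicative group of [F_(q^2)]. On
    both [B] and [C], [f g = mu a] for [g u = a u] is a linear character. Were the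
    pair strong Gelfand, [Theta = Ind_B^G f] and [Psi = Ind_C^M f] would satisfy
    [<Theta, Ind_M^G Psi> <= <Theta, Theta> <Psi, Psi>]. By Mackey, each inner
    product counts the double cosets on which the two linear characters agree:
    [<Theta, Theta> <= 2] (the cosets [B] and [B w B] inside the stabilizer of the
    point [F_q u]) and [<Psi, Psi> <= 1], whereas [C \ G / B] has at least three
    such cosets, those of the flag of [B], of the flag [F_q u < F_q^2], and of a
    flag whose stabilizer in [C] is trivial. *)

(** A multiplicative [f] is a representation by 1x1 matrices, and [alpha] is its character. *)
Lemma lin_char_of_fun (gT : finGroupType) (A : {group gT}) (f : gT -> algC) :
    f 1%g = 1 -> {in A &, {morph f : x y / (x * y)%g >-> x * y}} ->
  exists2 alpha : 'CF(A), alpha \is a linear_char & {in A, alpha =1 f}.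
Proof.
move=> f1 fM.
have rP : mx_repr A (fun x => (f x)%:M : 'M[algC]_1).
  by split=> [|x y Ax Ay]; rewrite ?f1 // fM // scalar_mxM.
exists (cfRepr (MxRepresentation rP)) => [|x Ax].
  by rewrite qualifE /= cfRepr_char cfRepr1 eqxx.
by rewrite cfunE Ax mulr1n mxtrace_scalar mulr1n.
Qed.

(** * Inner products of induced linear characters *)

Section Mackey.
Variables (gT : finGroupType) (G A C : {group gT}).
Variables (alpha : 'CF(A)) (beta : 'CF(C)).
Hypotheses (sAG : A \subset G) (sCG : C \subset G).
Hypotheses (lin_a : alpha \is a linear_char) (lin_b : beta \is a linear_char).

(** The Mackey term of [y]: up to the order of [A :&: C :^ y^-1], the inner product there of [alpha]
    with the [y]-conjugate of [beta]. All of [A] may be summed over because [beta] vanishes off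
    [C]. *)
Definition intertwining_sum (y : gT) : algC :=
  \sum_(x in A) alpha x * (beta (x ^ y)%g)^*.

(** Mackey's formula, summed over elements instead of double cosets so that no representatives need
    be chosen. *)
Lemma cfdot_Ind_Ind :
  '['Ind[G] alpha, 'Ind[G] beta] =
    (#|A| * #|C|)%:R^-1 * \sum_(y in G) intertwining_sum y.
Proof.
rewrite -Frobenius_reciprocity cfdotE natrM invfM -mulrA; congr (_ * _).
rewrite mulr_sumr (eq_bigr (fun x => \sum_(y in G)
    #|C|%:R^-1 * (alpha x * (beta (x ^ y)%g)^*))) => [|x Ax].
  by rewrite exchange_big /=; apply: eq_bigr => y _; rewrite mulr_sumr.
rewrite cfResE // cfIndE // rmorphM rmorph_sum fmorphV rmorph_nat /=.
by rewrite mulrCA !mulr_sumr; apply: eq_bigr => y _; rewrite mulrCA.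
Qed.

Lemma intertwining_sumE (y : gT) :
  intertwining_sum y =
    \sum_(x in (A :&: C :^ y^-1)%g) alpha x * (beta (x ^ y)%g)^*.
Proof.
rewrite /intertwining_sum (big_setID (C :^ y^-1)%g) /= [X in _ + X]big1 ?addr0 // => x.
rewrite inE mem_conjgV => /andP[Cx _].
by rewrite (cfun0 beta) // conjC0 mulr0.
Qed.

(** Translating the summation variable by [x0] multiplies the sum by [alpha x0 * (beta (x0 ^ y))^*],
    which is not 1. *)
Lemma intertwining_sum_eq0 (y x0 : gT) :
    x0 \in A -> (x0 ^ y)%g \in C -> alpha x0 != beta (x0 ^ y)%g ->
  intertwining_sum y = 0.
Proof.
move=> Ax0 Cx0 neq; rewrite intertwining_sumE.
set S := LHS; pose D := (A :&: (C :^ y^-1))%G.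
have Dx0 : x0 \in D by rewrite inE Ax0 mem_conjgV.
have eqS : alpha x0 * (beta (x0 ^ y)%g)^* * S = S.
  rewrite /S [RHS](reindex_inj (mulgI x0)) mulr_sumr /=.
  apply: eq_big => [x|x]; first by rewrite groupMl.
  rewrite inE mem_conjgV => /andP[Ax Cx].
  by rewrite conjMg (lin_charM lin_a) // (lin_charM lin_b Cx0 Cx) rmorphM /=; ring.
have b1 : (beta (x0 ^ y)%g)^* = (beta (x0 ^ y)%g)^-1.
  by rewrite invC_norm normC_lin_char // expr1n invr1 mul1r.
have b0 : beta (x0 ^ y)%g != 0 by rewrite lin_char_neq0.
apply/eqP; apply: contraR neq => S0; move/(canRL (mulfK S0)): eqS.
by rewrite divff // b1 => /(canRL (mulfVK b0)); rewrite mul1r => ->.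
Qed.

Lemma intertwining_sum_card (y : gT) :
    {in A, forall x, (x ^ y)%g \in C -> alpha x = beta (x ^ y)%g} ->
  intertwining_sum y = #|(A :&: C :^ y^-1)%g|%:R.
Proof.
move=> eq_ab; rewrite intertwining_sumE -sumr_const; apply: eq_bigr => x.
rewrite inE mem_conjgV => /andP[Ax Cx].
by rewrite eq_ab // -normCK normC_lin_char // expr1n.
Qed.

Lemma intertwining_sum_bounds (y : gT) :
  0 <= intertwining_sum y <= #|(A :&: C :^ y^-1)%g|%:R.
Proof.
have [/'forall_implyP eqf|] := boolP [forall x in A, (x ^ y \in C)%g ==> (alpha x == beta (x ^ y)%g)].
  rewrite intertwining_sum_card ?lexx ?ler0n // => x Ax Cx.
  by apply/eqP; apply: (implyP (eqf x Ax)).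
case/forallPn=> x; rewrite !negb_imply => /and3P[Ax Cx neq].
by rewrite (intertwining_sum_eq0 Ax Cx neq) lexx ler0n.
Qed.

Lemma intertwining_sum_double_coset (y a c : gT) :
  a \in A -> c \in C -> intertwining_sum (a * y * c)%g = intertwining_sum y.
Proof.
move=> Aa Cc; rewrite /intertwining_sum (reindex_inj (conjg_inj a^-1%g)) /=.
apply: eq_big => [x|x Ax]; first by rewrite memJ_norm // groupV (subsetP (normG A)).
by rewrite (cfunJ alpha) ?groupV // -conjgM !mulgA mulVg mul1g conjgM (cfunJ beta (x ^ y)%g).
Qed.

(** Hence a double coset on which the characters agree contributes exactly [#|A| * #|C|] to the sum
    over [G], that is, 1 to the inner product. *)
Lemma card_double_coset (y : gT) :
  (#|A :* y * C|%g * #|(A :&: C :^ y^-1)%g| = #|A| * #|C|)%N.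
Proof.
rewrite -[in RHS](cardJg C y^-1) mul_cardG; congr (_ * _)%N.
rewrite -(card_rcoset (A * C :^ y^-1)%g y); congr #|pred_of_set _|.
by rewrite conjsgE invgK -!mulgA mulg_set1 mulVg mulg1.
Qed.

Lemma double_cosetE (y z : gT) :
  reflect (exists a c, [/\ a \in A, c \in C & y = a * z * c]%g) (y \in A :* z * C)%g.
Proof.
apply: (iffP mulsgP) => [[b c /rcosetP[a Aa ->] Cc ->] | [a [c [Aa Cc ->]]]].
  by exists a, c.
by exists (a * z)%g c => //; apply/rcosetP; exists a.
Qed.

Lemma sum_intertwining_double_coset (y : gT) :
  \sum_(z in (A :* y * C)%g) intertwining_sum z =
    #|A :* y * C|%g%:R * intertwining_sum y.
Proof.
rewrite mulr_natl -sumr_const; apply: eq_bigr => z /double_cosetE[a [c [Aa Cc ->]]].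
exact: intertwining_sum_double_coset.
Qed.

Let double_coset_sub y : y \in G -> (A :* y * C \subset G)%g.
Proof.
move=> Gy; apply/subsetP => z /double_cosetE[a [c [Aa Cc ->]]].
by rewrite !groupM ?(subsetP sAG a) ?(subsetP sCG c).
Qed.

Let sum_double_cosets (ys : seq gT) : all [in G] ys ->
  \sum_(z <- ys) \sum_(y in (A :* z * C)%g) intertwining_sum y =
    \sum_(y in G) intertwining_sum y *+ count (fun z => y \in A :* z * C)%g ys.
Proof.
move=> /allP Gys; rewrite big_seq (eq_bigr (fun z => \sum_(y in G)
    intertwining_sum y *+ (y \in A :* z * C)%g)) => [|z /Gys Gz].
  rewrite -big_seq exchange_big /=; apply: eq_bigr => y _.
  by rewrite -sum1_count -sumrMnr [RHS]big_mkcond; apply: eq_bigr => z _; case: ifP.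
rewrite big_mkcond [RHS]big_mkcond; apply: eq_bigr => y _.
case: ifP => yD; last by rewrite if_same.
by rewrite (subsetP (double_coset_sub Gz) y yD).
Qed.

(** Elements outside the listed double cosets contribute 0, and each listed one at most
    [#|A| * #|C|]. Repetitions in [ys] are harmless, since all terms are nonnegative. *)
Lemma cfdot_Ind_Ind_le (ys : seq gT) :
    all [in G] ys ->
    (forall y, y \in G ->
       (exists x, [/\ x \in A, (x ^ y)%g \in C & alpha x != beta (x ^ y)%g])
       \/ has (fun z => y \in A :* z * C)%g ys) ->
  '['Ind[G] alpha, 'Ind[G] beta] <= (size ys)%:R.
Proof.
move=> Gys dich; rewrite cfdot_Ind_Ind ler_pdivrMl ?ltr0n ?muln_gt0 ?cardG_gt0 //.
apply: (@le_trans _ _ (\sum_(z <- ys) \sum_(y in (A :* z * C)%g) intertwining_sum y)).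
  rewrite sum_double_cosets //; apply: ler_sum => y Gy.
  case: (dich y Gy) => [[x [Ax Cx neq]] | hy].
    by rewrite (intertwining_sum_eq0 Ax Cx neq) mul0rn.
  have /andP[I0 _] := intertwining_sum_bounds y.
  by rewrite has_count in hy; rewrite -[leLHS]mulr1n; apply: ler_wpMn2l.
rewrite mulrC -sum1_size natr_sum mulr_suml; apply: ler_sum => z _.
rewrite sum_intertwining_double_coset mul1r -(card_double_coset z) natrM.
by apply: ler_wpM2l; rewrite ?ler0n //; have /andP[] := intertwining_sum_bounds z.
Qed.

(** Distinct double cosets are disjoint, so no element is counted twice, and each listed one
    contributes exactly [#|A| * #|C|]. *)
Lemma cfdot_Ind_Ind_ge (ys : seq gT) :
    all [in G] ys -> pairwise (fun z z' => z' \notin A :* z * C)%g ys ->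
    {in ys, forall y, {in A, forall x, (x ^ y)%g \in C -> alpha x = beta (x ^ y)%g}} ->
  (size ys)%:R <= '['Ind[G] alpha, 'Ind[G] beta].
Proof.
move=> Gys pw compat; rewrite cfdot_Ind_Ind ler_pdivlMl ?ltr0n ?muln_gt0 ?cardG_gt0 //.
apply: (@le_trans _ _ (\sum_(z <- ys) \sum_(y in (A :* z * C)%g) intertwining_sum y)).
  rewrite mulrC -sum1_size natr_sum mulr_suml big_seq [leRHS]big_seq.
  apply: ler_sum => z zys; rewrite sum_intertwining_double_coset mul1r.
  by rewrite (intertwining_sum_card (compat z zys)) -natrM card_double_coset.
rewrite sum_double_cosets //; apply: ler_sum => y Gy.
have /andP[I0 _] := intertwining_sum_bounds y.
rewrite -[leRHS]mulr1n; apply: ler_wpMn2l => //.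
rewrite -size_filter; set s := filter _ _.
have: all (fun z => y \in A :* z * C)%g s by apply: filter_all.
have: pairwise (fun z z' => z' \notin A :* z * C)%g s.
  exact: subseq_pairwise (filter_subseq _ _) pw.
case: s => [|z [|z' s]] //= /andP[/andP[/negP nz' _] _].
case/and3P=> /double_cosetE[a [c [Aa Cc ->]]] /double_cosetE[a' [c' [Aa' Cc' eq_z]]] _.
case: nz'; apply/double_cosetE; exists (a'^-1 * a)%g, (c * c'^-1)%g.
split; rewrite ?groupM ?groupV //.
apply: (mulgI a'); apply: (mulIg c'); rewrite -eq_z.
by rewrite !mulgA mulgV mul1g mulgKV.
Qed.
End Mackey.

(* A strong Gelfand pair bounds the left-hand side by the product of the numbers of
   irreducible constituents, counted with multiplicity, of [psi] and of [theta]. *)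
Lemma strong_Gelfand_cfdot_Ind_le (gT : finGroupType) (G H : {group gT})
    (psi : 'CF(H)) (theta : 'CF(G)) :
    strong_Gelfand G H -> psi \is a character -> theta \is a character ->
  '['Ind[G] psi, theta] <= '[psi] * '[theta].
Proof.
move=> SG Npsi Ntheta.
(* Multiplicities are natural numbers, so each is at most its square. *)
have sq_le (K : {group gT}) (chi : 'CF(K)) i : chi \is a character ->
    '[chi, 'chi_i] <= '[chi, 'chi_i] ^+ 2.
  move=> Nchi; have /natrP[n ->] := Cnat_cfdot_char_irr i Nchi.
  by rewrite -natrX ler_nat; case: n => // n; rewrite leq_pmulr.
rewrite {1}[psi]cfun_sum_cfdot linear_sum cfdot_suml [X in _ <= X * _]cfdot_char_r //.
rewrite mulr_suml; apply: ler_sum => i _.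
have i0 : 0 <= '[psi, 'chi_i] by rewrite natr_ge0 ?Cnat_cfdot_char_irr.
rewrite linearZ cfdotZl /=; apply: (@le_trans _ _ ('[psi, 'chi_i] * '[theta])); last first.
  by rewrite -expr2 ler_wpM2r ?cfnorm_ge0 ?sq_le.
apply: ler_wpM2l => //; rewrite {1}[theta]cfun_sum_cfdot cfdot_sumr [leRHS]cfdot_char_r //.
apply: ler_sum => j _; rewrite cfdotZr.
have j0 : '[theta, 'chi_j] \is a Num.nat by rewrite Cnat_cfdot_char_irr.
rewrite conj_natr //; apply: le_trans (sq_le _ _ j Ntheta).
(* By [SG], the remaining factor, the multiplicity of ['chi_j] in the induced ['chi_i], is at most
   1. *)
by rewrite ler_piMr ?natr_ge0.
Qed.

(** * Finite fields *)

Lemma finField_prim_root (F : finFieldType) :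
  {g : F | (#|F|.-1).-primitive_root g}.
Proof.
apply: sigW; have n_gt0 : (0 < #|F|.-1)%N by rewrite -subn1 subn_gt0 finNzRing_gt1.
have: has (#|F|.-1).-primitive_root [seq x <- enum F | x != 0].
  apply: has_prim_root => //; last 2 first.
  - by rewrite filter_uniq ?enum_uniq.
  - by rewrite -(cardC1 (0 : F)) cardE enumT.
  apply/allP => x; rewrite mem_filter => /andP[x0 _]; apply/unity_rootP.
  by apply: (mulfI x0); rewrite mulr1 -exprS prednK ?expf_card // ltnW ?finNzRing_gt1.
by case/hasP=> g _ prim_g; exists g.
Qed.

Lemma prim_root_neq0 (F : fieldType) (n : nat) (z : F) : n.-primitive_root z -> z != 0.
Proof.
move=> prim_z; apply/eqP => z0; have := prim_expr_order prim_z.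
by move/eqP; rewrite z0 expr0n eqn0Ngt (prim_order_gt0 prim_z) eq_sym oner_eq0.
Qed.

(** A generator is sent to a complex root of unity of the same order. The value 0 at 0 keeps [mu]
    multiplicative and injective on all of [F]. *)
Lemma finField_faithful_mul_char (F : finFieldType) :
  exists mu : F -> algC, [/\ mu 1 = 1, {morph mu : x y / x * y} & injective mu].
Proof.
have [g prim_g] := finField_prim_root F; set n := #|F|.-1 in prim_g.
have n_gt0 := prim_order_gt0 prim_g.
have [z prim_z] := C_prim_root_exists n_gt0.
pose mu (x : F) : algC := if [pick i : 'I_n | x == g ^+ i] is Some i then z ^+ i else 0.
have g0 := prim_root_neq0 prim_g.
have z0 := prim_root_neq0 prim_z.
have muX k : mu (g ^+ k) = z ^+ k.
  rewrite /mu; case: pickP => [i /eqP eq_g | /(_ (Ordinal (ltn_pmod k n_gt0)))].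
    apply/eqP; rewrite (eq_prim_root_expr prim_z) -(eq_prim_root_expr prim_g).
    by rewrite eq_g.
  by rewrite /= (prim_expr_mod prim_g) eqxx.
have mu0 : mu 0 = 0.
  by rewrite /mu; case: pickP => // i /eqP/esym/eqP; rewrite expf_eq0 (negPf g0) andbF.
have gX x : x = 0 \/ exists k, x = g ^+ k.
  have [->|x0] := eqVneq x 0; [by left | right].
  have [|i ->] := prim_rootP prim_g (_ : x ^+ n = 1); last by exists i.
  by apply: (mulfI x0); rewrite mulr1 -exprS prednK ?expf_card // ltnW ?finNzRing_gt1.
exists mu; split=> [|x y|x y]; first by rewrite -(expr0 g) muX expr0.
  have [->|[i ->]] := gX x; first by rewrite !(mul0r, mu0).
  have [->|[j ->]] := gX y; first by rewrite !(mulr0, mu0).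
  by rewrite -exprD !muX exprD.
have [->|[i ->]] := gX x; have [->|[j ->]] := gX y; rewrite ?mu0 ?muX //.
- by move/esym/eqP; rewrite expf_eq0 (negPf z0) andbF.
- by move/eqP; rewrite expf_eq0 (negPf z0) andbF.
by move/eqP; rewrite (eq_prim_root_expr prim_z) -(eq_prim_root_expr prim_g) => /eqP.
Qed.

(** * The extension of [F_q] by [F_(q^2)] and its trace *)

Section QuadraticExtension.
Variables (e : nat) (L : finFieldType).
Hypotheses (e_gt1 : (1 < e)%N) (cardL : #|L| = (2 ^ (2 * e))%N).

Local Notation q := (qq e).
Local Notation inK := (in_K e).
Local Notation tr := (trLK e).

Lemma pchar2 : 2%N \in [pchar L].
Proof. exact: card_finPcharP cardL _. Qed.

(* [ring] cannot exploit [2 = 0]; [z] is half of the difference computed without it. *)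
Lemma char2_eq (z x y : L) : x = y + z *+ 2 -> x = y.
Proof. by rewrite (mulrn_pchar pchar2) addr0. Qed.

Lemma frobD (x y : L) : (x + y) ^+ q = x ^+ q + y ^+ q.
Proof. by rewrite exprDn_pchar // pnatX pnatE ?pchar2. Qed.

Lemma frobK (x : L) : (x ^+ q) ^+ q = x.
Proof. by rewrite -exprM -expnD addnn -mul2n -cardL expf_card. Qed.

Lemma q_gt0 : (0 < q)%N. Proof. by rewrite expn_gt0. Qed.

Lemma frob0 : (0 : L) ^+ q = 0.
Proof. by rewrite expr0n eqn0Ngt q_gt0. Qed.

Lemma inK0 : inK (0 : L). Proof. by rewrite /in_K frob0. Qed.
Lemma inK1 : inK (1 : L). Proof. by rewrite /in_K expr1n. Qed.
Lemma inKD (x y : L) : inK x -> inK y -> inK (x + y).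
Proof. by rewrite /in_K frobD => /eqP-> /eqP->. Qed.
Lemma inKM (x y : L) : inK x -> inK y -> inK (x * y).
Proof. by rewrite /in_K exprMn => /eqP-> /eqP->. Qed.
Lemma inKV (x : L) : inK x -> inK x^-1.
Proof. by rewrite /in_K exprVn => /eqP->. Qed.

Lemma trD (x y : L) : tr (x + y) = tr x + tr y.
Proof. by rewrite /trLK frobD addrACA. Qed.
Lemma trZ (a x : L) : inK a -> tr (a * x) = a * tr x.
Proof. by rewrite /trLK exprMn mulrDr => /eqP->. Qed.
Lemma inK_tr (x : L) : inK (tr x).
Proof. by rewrite /in_K frobD frobK addrC. Qed.
(** Special to characteristic 2: the kernel of the trace is [K] itself, so that [K^2] is totally
    isotropic. *)
Lemma tr_eq0 (x : L) : (tr x == 0) = inK x.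
Proof. by rewrite /trLK addr_eq0 (oppr_pchar2 pchar2) eq_sym. Qed.
Lemma tr_K (x : L) : inK x -> tr x = 0.
Proof. by rewrite -tr_eq0 => /eqP. Qed.

Lemma tr0 : tr (0 : L) = 0.
Proof. exact: tr_K inK0. Qed.

Lemma pred_qM : (q * q).-1 = #|L|.-1.
Proof. by rewrite -expnD addnn -mul2n cardL. Qed.

Lemma q_ge4 : (4 <= q)%N.
Proof. by rewrite -[4%N]/(2 ^ 2)%N leq_exp2l. Qed.

(** A generator of the multiplicative group lies outside [K], so its trace is nonzero and can be
    scaled to 1. Such a [c] forms with 1 a [K]-basis of [L]. *)
Lemma exists_tr1 : exists c : L, tr c = 1.
Proof.
have [g prim_g] := finField_prim_root L.
have /negPf gK : ~~ inK g.
  rewrite /in_K -{2}(expr1 g) (eq_prim_root_expr prim_g) -pred_qM !modn_small //.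
  - by have := q_ge4; lia.
  - by have := q_ge4; nia.
  - by have := q_ge4; nia.
rewrite -tr_eq0 in gK; exists ((tr g)^-1 * g).
by rewrite trZ ?inKV ?inK_tr // mulVf ?gK.
Qed.

(** The norm [g ^+ q.+1] of a generator is not 1 because [q + 1 < q^2 - 1], which is where [q > 2]
    is needed. *)
Lemma exists_inK_neq01 : exists2 a : L, inK a & (a != 0) && (a != 1).
Proof.
have [g prim_g] := finField_prim_root L.
exists (g ^+ q.+1).
  rewrite /in_K -exprM (eq_prim_root_expr prim_g) -pred_qM.
  by rewrite -(modnDr q.+1); apply/eqP; congr (_ %% _)%N; have := q_ge4; nia.
rewrite expf_neq0 ?(prim_root_neq0 prim_g) //=.
rewrite -(prim_order_dvd prim_g) -pred_qM gtnNdvd //.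
by have := q_ge4; nia.
Qed.

(** * The alternating form on [L^2] *)

Local Notation vec := (L * L)%type.
Local Notation B := (@Bform L e).
Local Notation u0 := (1 : L, 0 : L).

Lemma BformDl (u v w : vec) : B (vadd u v) w = B u w + B v w.
Proof. by rewrite /Bform -trD /beta /=; congr trLK; ring. Qed.
Lemma BformZl (a : L) (u v : vec) : inK a -> B (vscale a u) v = a * B u v.
Proof. by move=> Ka; rewrite /Bform -trZ // /beta /=; congr trLK; ring. Qed.
Lemma BformC (u v : vec) : B u v = B v u.
Proof.
rewrite /Bform /beta; congr trLK.
by apply: (char2_eq (z := u.1 * v.2 - u.2 * v.1)); ring.
Qed.
Lemma BformDr (u v w : vec) : B w (vadd u v) = B w u + B w v.
Proof. by rewrite !(BformC w) BformDl. Qed.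
Lemma BformZr (a : L) (u v : vec) : inK a -> B v (vscale a u) = a * B v u.
Proof. by move=> Ka; rewrite !(BformC v) BformZl. Qed.
Lemma Bform_self (u : vec) : B u u = 0.
Proof. by rewrite /Bform /beta mulrC subrr tr_K ?inK0. Qed.
Lemma inK_Bform (u v : vec) : inK (B u v).
Proof. exact: inK_tr. Qed.

Lemma Bform_coordE (x y x' y' : L) : B (x, y) (x', y') = tr (x * y') + tr (y * x').
Proof. by rewrite /Bform /beta /= (oppr_pchar2 pchar2) trD. Qed.

Lemma Bform_nondeg (u : vec) : (forall v, B u v = 0) -> u = (0, 0).
Proof.
case: u => x y B0; have [c trc] := exists_tr1.
have x0 : x = 0.
  apply/eqP/negP => /negP x0; have := B0 (0, x^-1 * c); rewrite Bform_coordE.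
  by rewrite mulr0 mulVKf // tr0 addr0 trc => /eqP; rewrite oner_eq0.
have y0 : y = 0.
  apply/eqP/negP => /negP y0; have := B0 (y^-1 * c, 0); rewrite Bform_coordE.
  by rewrite mulr0 mulVKf // tr0 add0r trc => /eqP; rewrite oner_eq0.
by rewrite x0 y0.
Qed.

Lemma vadd0 (u v : vec) : vadd u v = (0, 0) -> u = v.
Proof.
case: u v => [x y] [x' y'] [/eqP + /eqP]; rewrite !addr_eq0 !(oppr_pchar2 pchar2).
by move=> /eqP-> /eqP->.
Qed.

(** * Isometries as functions and as permutations *)

Definition Sp4_map (h : vec -> vec) : Prop :=
  [/\ forall u v, h (vadd u v) = vadd (h u) (h v),
      forall a u, inK a -> h (vscale a u) = vscale a (h u) &
      forall u v, B (h u) (h v) = B u v].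

Definition Sp2_map (h : vec -> vec) : Prop :=
  [/\ forall u v, h (vadd u v) = vadd (h u) (h v),
      forall a u, h (vscale a u) = vscale a (h u) &
      forall u v, beta (h u) (h v) = beta u v].

Lemma Sp4_setP (g : {perm vec}) : reflect (Sp4_map g) (g \in Sp4_set L e).
Proof.
rewrite inE; apply: (iffP idP) => [H | [gD gZ gB]].
  have {}H u v c := and3P (forallP (forallP (forallP H u) v) c).
  split=> [u v | a u Ka | u v].
  - by have [/eqP] := H u v 0.
  - by have [_ /implyP/(_ Ka)/eqP] := H u u a.
  - by have [_ _ /eqP] := H u v 0.
apply/forallP=> u; apply/forallP=> v; apply/forallP=> c.
rewrite gD gB !eqxx andbT /=; apply/implyP=> Kc; by rewrite gZ.
Qed.

Lemma Sp2_setP (g : {perm vec}) : reflect (Sp2_map g) (g \in Sp2_set L).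
Proof.
rewrite inE; apply: (iffP idP) => [H | [gD gZ gB]].
  have {}H u v c := and3P (forallP (forallP (forallP H u) v) c).
  split=> [u v | a u | u v].
  - by have [/eqP] := H u v 0.
  - by have [_ /eqP] := H u u a.
  - by have [_ _ /eqP] := H u v 0.
by apply/forallP=> u; apply/forallP=> v; apply/forallP=> c; rewrite gD gB gZ !eqxx.
Qed.

Lemma Sp2_map_Sp4 (h : vec -> vec) : Sp2_map h -> Sp4_map h.
Proof. by case=> hD hZ hB; split=> // u v; rewrite /Bform hB. Qed.

Lemma Sp4_map_inj (h : vec -> vec) : Sp4_map h -> injective h.
Proof.
case=> hD hZ hB u v eq_h; apply: vadd0; apply: Bform_nondeg => w.
by rewrite -hB hD eq_h BformDl (addrr_pchar2 pchar2).
Qed.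

(** Nondegeneracy makes an isometry injective, so group elements can be given by formulas. *)
Lemma Sp4_map_perm (h : vec -> vec) : Sp4_map h ->
  exists2 g : {perm vec}, g \in Sp4_set L e & g =1 h.
Proof.
move=> Sh; have eq_g := permE (Sp4_map_inj Sh).
exists (perm (Sp4_map_inj Sh)) => //; apply/Sp4_setP; case: Sh eq_g => hD hZ hB /= eq_g.
by split=> *; rewrite !eq_g ?hD ?hZ ?hB.
Qed.

Lemma Sp2_map_perm (h : vec -> vec) : Sp2_map h ->
  exists2 g : {perm vec}, g \in Sp2_set L & g =1 h.
Proof.
move=> Sh; have [g _ eq_g] := Sp4_map_perm (Sp2_map_Sp4 Sh).
exists g => //; apply/Sp2_setP; case: Sh eq_g => hD hZ hB eq_g.
by split=> *; rewrite !eq_g ?hD ?hZ ?hB.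
Qed.

Lemma Sp2_sub_Sp4 : Sp2_set L \subset Sp4_set L e.
Proof. by apply/subsetP=> g /Sp2_setP Sg; apply/Sp4_setP/Sp2_map_Sp4. Qed.

Lemma Sp4_group_set : group_set (Sp4_set L e).
Proof.
apply/group_setP; split=> [|g h /Sp4_setP[gD gZ gB] /Sp4_setP[hD hZ hB]].
  by apply/Sp4_setP; split=> *; rewrite !perm1.
by apply/Sp4_setP; split=> *; rewrite !permM ?gD ?hD ?gZ ?hZ // hB gB.
Qed.

Lemma Sp2_group_set : group_set (Sp2_set L).
Proof.
apply/group_setP; split=> [|g h /Sp2_setP[gD gZ gB] /Sp2_setP[hD hZ hB]].
  by apply/Sp2_setP; split=> *; rewrite !perm1.
by apply/Sp2_setP; split=> *; rewrite !permM ?gD ?hD ?gZ ?hZ // hB gB.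
Qed.

Lemma SpGE (g : {perm vec}) : (g \in SpG L e) = (g \in Sp4_set L e).
Proof. by rewrite /= gen_set_id ?Sp4_group_set. Qed.

Lemma MG_sub_SpG : MG L e \subset SpG L e.
Proof.
rewrite gen_subG subUset; apply/andP; split; apply/subsetP => g.
  by move=> Sg; rewrite SpGE (subsetP Sp2_sub_Sp4).
rewrite inE SpGE => /forallP eqg; have {}eqg u := eqP (eqg u).
apply/Sp4_setP; split=> [u v | a u Ka | u v]; rewrite !eqg /vadd /vscale /=.
- by rewrite !frobD.
- by rewrite !exprMn (eqP Ka).
by rewrite /Bform /beta /= -!exprMn !(oppr_pchar2 pchar2) -frobD /trLK frobK addrC.
Qed.

Definition semilinear_isometry (g : {perm vec}) : Prop :=
  exists2 sigma : L -> L, sigma =1 id \/ sigma =1 (fun x => x ^+ q) &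
  [/\ forall u v, g (vadd u v) = vadd (g u) (g v),
      forall a u, g (vscale a u) = vscale (sigma a) (g u) &
      forall u v, beta (g u) (g v) = sigma (beta u v)].

(** Induction on the length of a word in the generators; the twists compose within a group of order
    2 by [frobK]. *)
Lemma MG_semilinear (g : {perm vec}) : g \in MG L e -> semilinear_isometry g.
Proof.
case/gen_prodgP=> n [c Gc ->]; elim: n c Gc => [|n IHn] c Gc.
  rewrite big_ord0; exists id; first by left.
  by split=> *; rewrite !perm1.
rewrite big_ord_recl.
have [tau tauE [gD gZ gB]] := IHn (fun i => c (lift ord0 i)) (fun i => Gc _).
have [sigma sigmaE [hD hZ hB]] : semilinear_isometry (c ord0).
  have := Gc ord0; rewrite inE => /orP[/Sp2_setP[hD hZ hB] | ].
    by exists id => //; left.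
  rewrite inE => /forallP eqg; have {}eqg u := eqP (eqg u).
  exists (fun x => x ^+ q); first by right.
  split=> *; rewrite !eqg /vadd /vscale /beta /=.
  - by rewrite !frobD.
  - by rewrite !exprMn.
  by rewrite !(oppr_pchar2 pchar2) frobD !exprMn.
exists (tau \o sigma); last first.
  by split=> *; rewrite !permM ?hD ?gD ?hZ ?gZ // gB hB.
have {}tauE : tau =1 id \/ tau =1 (fun x => x ^+ q) by [].
case: sigmaE tauE => sE [] tE; [left | right | right | left] => x /=;
  by rewrite tE sE ?frobK.
Qed.

(** In characteristic 2, [a^2 = 1] would give [(a - 1)^2 = 0]. This separates the two eigenvalues of
    a dilation. *)
Lemma neq_invr (a : L) : a != 0 -> a != 1 -> a != a^-1.
Proof.
move=> a0; apply: contra => /eqP aV; have aa : a * a = 1 by rewrite {2}aV divff.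
rewrite -subr_eq0 -sqrf_eq0; apply/eqP/(char2_eq (z := 1 - a)).
by ring: aa.
Qed.

(** * The flag stabilizer and the Borel subgroup *)

Lemma Sp4_map0 (h : vec -> vec) : Sp4_map h -> h (0, 0) = (0, 0).
Proof.
case=> _ hZ _; have := hZ 0 u0 inK0.
by rewrite /vscale /= !mul0r.
Qed.

Lemma Sp4_map_scale_u0 (h : vec -> vec) (a : L) :
  Sp4_map h -> inK a -> h (a, 0) = vscale a (h u0).
Proof. by case=> _ hZ _ Ka; rewrite -hZ // /vscale /= mulr1 mulr0. Qed.

Lemma Sp2_map_scale_u0 (h : vec -> vec) (a : L) :
  Sp2_map h -> h (a, 0) = vscale a (h u0).
Proof. by case=> _ hZ _; rewrite -hZ // /vscale /= mulr1 mulr0. Qed.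

(* The stabilizer in [Sp4(q)] of the flag [K (1, 0) < L (1, 0)]. *)
Definition flag_set : {set {perm vec}} :=
  [set g in Sp4_set L e | inK (g u0).1 && [forall x, (g (x, 0)).2 == 0]].

Definition borel_set : {set {perm vec}} :=
  [set g in Sp2_set L | (g u0).2 == 0].

Lemma flag_setP (g : {perm vec}) :
  reflect [/\ Sp4_map g, exists2 a, inK a & g u0 = (a, 0) & forall x, (g (x, 0)).2 = 0]
          (g \in flag_set).
Proof.
rewrite inE; apply: (iffP and3P) => [[/Sp4_setP Sg Ka /forallP g2] | [Sg [a Ka gu] g2]].
  split=> // [|x]; last exact/eqP.
  by exists (g u0).1 => //; rewrite [LHS]surjective_pairing (eqP (g2 1)).
split; [exact/Sp4_setP | by rewrite gu | by apply/forallP=> x; rewrite g2].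
Qed.

Lemma borel_setP (g : {perm vec}) :
  reflect (Sp2_map g /\ exists a, g u0 = (a, 0)) (g \in borel_set).
Proof.
rewrite inE; apply: (iffP andP) => [[/Sp2_setP Sg /eqP g2] | [Sg [a gu]]].
  by split=> //; exists (g u0).1; rewrite [LHS]surjective_pairing g2.
by split; [exact/Sp2_setP | rewrite gu].
Qed.

Lemma borel_scale (g : {perm vec}) : g \in borel_set ->
  exists2 a, a != 0 & forall x, g (x, 0) = (a * x, 0).
Proof.
case/borel_setP=> Sg [a gu]; exists a => [|x].
  apply/eqP=> a0; have: g u0 = g (0, 0) by rewrite gu a0 Sp4_map0 //; apply: Sp2_map_Sp4.
  by move/perm_inj => [/eqP]; rewrite oner_eq0.
by rewrite Sp2_map_scale_u0 // gu /vscale /= mulr0 mulrC.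
Qed.

Lemma flag_group_set : group_set flag_set.
Proof.
apply/group_setP; split=> [|g h].
  apply/flag_setP; split=> [||x]; rewrite ?perm1 //; last by exists 1; rewrite ?inK1.
  by apply/Sp4_setP/(group1 (Group Sp4_group_set)).
move=> /flag_setP[Sg [a Ka gu] g2] /flag_setP[Sh [b Kb hu] h2]; apply/flag_setP; split=> [||x].
- by apply/Sp4_setP/(groupM (G := Group Sp4_group_set)); apply/Sp4_setP.
- exists (a * b); rewrite ?inKM //.
  by rewrite permM gu Sp4_map_scale_u0 // hu /vscale /= mulr0.
by rewrite permM [g _]surjective_pairing g2 h2.
Qed.

Lemma borel_group_set : group_set borel_set.
Proof.
apply/group_setP; split=> [|g h].
  apply/borel_setP; split; last by exists 1; rewrite perm1.
  by apply/Sp2_setP/(group1 (Group Sp2_group_set)).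
move=> /borel_setP[Sg [a gu]] /borel_setP[Sh [b hu]]; apply/borel_setP; split.
  by apply/Sp2_setP/(groupM (G := Group Sp2_group_set)); apply/Sp2_setP.
by exists (a * b); rewrite permM gu Sp2_map_scale_u0 // hu /vscale /= mulr0.
Qed.

Definition flag_group : {group {perm vec}} := Group flag_group_set.
Definition borel_group : {group {perm vec}} := Group borel_group_set.

Lemma flag_sub_SpG : flag_group \subset SpG L e.
Proof. by apply/subsetP=> g; rewrite SpGE inE => /andP[]. Qed.

Lemma borel_sub_MG : borel_group \subset MG L e.
Proof.
by apply/subsetP=> g; rewrite inE => /andP[Sg _]; rewrite mem_gen // inE Sg.
Qed.

Lemma conj_permE (x y : {perm vec}) (u : vec) : (x ^ y)%g u = y (x (y^-1%g u)).
Proof. by rewrite conjgE !permM. Qed.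

(** Since 1 and [c] span [L] over [K], the line [L u0] is preserved as soon as [u0] and [(c, 0)] are
    sent into it. *)
Lemma mem_flag_group (c a : L) (g : {perm vec}) :
    tr c = 1 -> g \in Sp4_set L e -> inK a -> g u0 = (a, 0) -> (g (c, 0)).2 = 0 ->
  g \in flag_group.
Proof.
move=> trc Sg Ka gu gc; apply/flag_setP; split=> [||x]; first exact/Sp4_setP.
  by exists a.
have /Sp4_setP[gD gZ _] := Sg.
have Kr : inK (x + tr x * c).
  rewrite -tr_eq0 trD trZ ?inK_tr // trc mulr1.
  by rewrite (addrr_pchar2 pchar2).
have -> : (x, 0) = vadd (vscale (x + tr x * c) u0) (vscale (tr x) (c, 0)).
  rewrite /vadd /vscale /=; congr (_, _); last by ring.
  by apply: (char2_eq (z := - (tr x * c))); ring.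
by rewrite gD !gZ ?inK_tr // gu /= gc !mulr0 addr0.
Qed.

(** * Explicit isometries *)

Lemma transvection (k : L) (d : vec) : inK k ->
  Sp4_map (fun u => vadd u (vscale (k * B u d) d)).
Proof.
move=> Kk; split=> [u v | a u Ka | u v].
- by rewrite BformDl /vadd /vscale /=; congr (_, _); ring.
- by rewrite BformZl // /vadd /vscale /=; congr (_, _); ring.
rewrite !(BformDl, BformDr) !(BformZl, BformZr) ?inKM ?inK_Bform // Bform_self (BformC d v).
by apply: (char2_eq (z := k * B u d * B v d)); ring.
Qed.

(* The isometry scaling [v] by [a] and [z] by [a^-1], and fixing the orthogonal of both. *)
Lemma hyperbolic_dilation (a : L) (v z : vec) : inK a -> a != 0 -> B v z = 1 ->
  Sp4_map (fun u => vadd u (vadd (vscale ((a + 1) * B u z) v)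
                                 (vscale ((a^-1 + 1) * B u v) z))).
Proof.
move=> Ka a0 Bvz; have Ka1 : inK (a + 1) by rewrite inKD ?inK1.
have Kb1 : inK (a^-1 + 1) by rewrite inKD ?inK1 ?inKV.
split=> [u t | b u Kb | u t].
- by rewrite !BformDl /vadd /vscale /=; congr (_, _); ring.
- by rewrite !BformZl // /vadd /vscale /=; congr (_, _); ring.
rewrite !(BformDl, BformDr) !(BformZl, BformZr) ?inKM ?inK_Bform // !Bform_self.
rewrite !(BformC v t) !(BformC z) Bvz.
apply: (char2_eq (z := (a + 2 + a^-1) * (B u v * B t z + B u z * B t v))).
by field.
Qed.

Lemma upper_triangular (a k : L) : a != 0 ->
  Sp2_map (fun u => (a * u.1 + k * u.2, a^-1 * u.2)).
Proof.
move=> a0; split=> [u v | b u | u v]; rewrite /vadd /vscale /beta /=.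
- by congr (_, _); ring.
- by congr (_, _); ring.
by field.
Qed.

(** The determinant is -1, which is 1 in characteristic 2. *)
Lemma coordinate_swap : Sp2_map (fun u => (u.2, u.1)).
Proof.
split=> [u v | b u | u v]; rewrite /vadd /vscale /beta //=.
by apply: (char2_eq (z := u.2 * v.1 - u.1 * v.2)); ring.
Qed.

(* Write [v = y^-1 u0]. A hyperbolic dilation scaling [u0] by [a] and [v] by [a^-1],
   when they are not orthogonal, or scaling [u0] by [a] and fixing [v], when they
   span a totally isotropic plane, shows that the characters disagree; when [v] and
   [u0] are [K]-proportional and [y] does not fix the flag, a transvection along [(c, 0)] moves the flag
   [y^-1 (K u0 < L u0)] to [K u0 < K^2]. *)
Lemma flag_dichotomy (c : L) (w y : {perm vec}) :
    tr c = 1 -> w \in Sp4_set L e ->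
    (forall u, w u = vadd u (vscale (B u (c, 1)) (c, 1))) ->
    y \in Sp4_set L e ->
  (exists x, [/\ x \in flag_group, (x ^ y)%g \in flag_group & (x u0).1 != ((x ^ y)%g u0).1])
  \/ y \in flag_group \/ exists b d, [/\ b \in flag_group, d \in flag_group & y = b * w * d]%g.
Proof.
move=> trc Sw wE Sy; have /Sp4_setP[yD yZ yB] := Sy.
have SGM := groupM (G := Group Sp4_group_set); have SGV := groupVr (G := Group Sp4_group_set).
have SGJ x : x \in Sp4_set L e -> (x ^ y)%g \in Sp4_set L e.
  by move=> Sx; apply: (groupJ (G := Group Sp4_group_set)).
have [a Ka /andP[a0 a1]] := exists_inK_neq01.
have Bc0 (x t : L) : B (x, 0) (t, 0) = 0.
  by rewrite Bform_coordE mulr0 mul0r tr0 addr0.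
set v := (y^-1)%g u0; have yv : y v = u0 by rewrite permKV.
set s := (y^-1)%g (c, 0); have ys : y s = (c, 0) by rewrite permKV.
have Bsv : B s v = 0 by rewrite -yB ys yv.
have [Bp|Bp] := eqVneq (B u0 v) 0; last first.
  (* [u0] and [z] form a hyperbolic pair with [z] proportional to [v]. As [s] is orthogonal to [v],
     the dilation moves [s] only by a multiple of [v], hence preserves the plane of [v] and [s]. *)
  left; set z := vscale (B u0 v)^-1 v.
  have Bz u : B u z = (B u0 v)^-1 * B u v by rewrite BformZr ?inKV ?inK_Bform.
  have Bu0z : B u0 z = 1 by rewrite Bz mulVf.
  have [x Sx xE] := Sp4_map_perm (hyperbolic_dilation Ka a0 Bu0z).
  have xu : x u0 = (a, 0).
    rewrite xE Bu0z Bc0 /vadd /vscale /=; congr (_, _); last by ring.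
    by apply: (char2_eq (z := 1)); ring.
  have xv : x v = vscale a^-1 v.
    rewrite xE Bz Bform_self (BformC v) /z /vadd /vscale /=; congr (_, _).
      by apply: (char2_eq (z := v.1)); field; rewrite a0 Bp.
    by apply: (char2_eq (z := v.2)); field; rewrite a0 Bp.
  have xyu : (x ^ y)%g u0 = (a^-1, 0).
    by rewrite conj_permE -/v xv yZ ?inKV // yv /vscale /= mulr1 mulr0.
  exists x; split; last 1 first.
  - by rewrite xu xyu neq_invr.
  - apply: (mem_flag_group trc Sx Ka xu).
    by rewrite xE Bc0 /vadd /vscale /=; ring.
  apply: (mem_flag_group trc (SGJ _ Sx) (inKV Ka) xyu).
  rewrite conj_permE -/s xE Bz Bsv; set k := _ * B s u0.
  have Kk : inK k := inKM (inKD (inKV Ka) inK1) (inK_Bform _ _).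
  rewrite !mulr0 /z !yD !yZ ?inK0 ?Kk ?inKV ?inK_Bform // ys yv /vadd /vscale /=.
  by ring.
case vE: ((v.2 == 0) && inK v.1).
  right; have [/eqP v2 Kv] := andP vE; have {}vE : v = (v.1, 0) by rewrite -v2 -surjective_pairing.
  have v0 : v.1 != 0.
    apply/eqP => v1; move: yv; rewrite vE v1 (Sp4_map0 (h := y)); last exact/Sp4_setP.
    by case=> /esym/eqP; rewrite oner_eq0.
  case: (eqVneq s.2 0) => [s2 | s2]; [left | right].
    by rewrite -groupV; apply: (mem_flag_group trc (SGV _ Sy) Kv vE); rewrite -/s.
  have Ks2 : inK s.2.
    move/eqP: Bsv; rewrite vE [s]surjective_pairing Bform_coordE mulr0 tr0 add0r mulrC trZ //.
    by rewrite mulf_eq0 (negPf v0) tr_eq0.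
  (* With this [k] the transvection adds [tr s.1 * c] to [s.1], which puts it in [K]; then [w]
     carries [K^2] to [L u0]. *)
  pose k := tr s.1 / s.2; have Kk : inK k by rewrite inKM ?inKV ?inK_tr.
  have [b Sb bE] := Sp4_map_perm (transvection (c, 0) Kk).
  have bc x : b (x, 0) = (x, 0).
    by rewrite bE Bc0 /vadd /vscale /=; congr (_, _); ring.
  have Bb : b \in flag_group.
    by apply: (mem_flag_group trc Sb inK1 (bc 1)); rewrite bc.
  exists b, (y^-1 * b * w)^-1%g; split=> //; last first.
    by rewrite !invMg invgK !mulgA mulgK mulgV mul1g.
  rewrite groupV; apply: (mem_flag_group trc _ Kv); first by rewrite !SGM ?SGV.
    rewrite !permM -/v vE bc wE Bform_coordE mulr1 mul0r tr0 tr_K // /vadd /vscale /=.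
    by congr (_, _); ring.
  have Bsc : B s (c, 0) = s.2.
    by rewrite [s in LHS]surjective_pairing Bform_coordE mulr0 tr0 add0r trZ // trc mulr1.
  have bs : b s = (s.1 + tr s.1 * c, s.2).
    rewrite bE Bsc /vadd /vscale /=; congr (_, _); last by ring.
    by rewrite /k; field.
  rewrite !permM -/s bs wE Bform_coordE mulr1 (trZ c Ks2) trc trD (trZ c (inK_tr _)) trc.
  rewrite /vadd /vscale /=; apply: (char2_eq (z := s.2 + tr s.1)); ring.
left.
(* The dilation on [u0] and [z] must fix [v], whence [B v z = 0], and must send [s] into the plane
   [y^-1 (L u0)]. *)
have [z Bu0z [Bvz xs2]] : exists2 z, B u0 z = 1 & B v z = 0 /\
    (y (vadd s (vadd (vscale ((a + 1) * B s z) u0)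
                     (vscale ((a^-1 + 1) * B s u0) z)))).2 = 0.
  have [Bs|Bs] := eqVneq (B s u0) 0; last first.
    (* With [z] a multiple of [s], the dilation scales [s] by [a^-1]. *)
    exists (vscale (B s u0)^-1 s).
      by rewrite BformZr ?inKV ?inK_Bform // (BformC u0) mulVf.
    rewrite !BformZr ?inKV ?inK_Bform // (BformC v) Bsv mulr0; split=> //.
    rewrite Bform_self !mulr0.
    suff -> : forall t, vadd s (vadd (vscale 0 t) (vscale ((a^-1 + 1) * B s u0) (vscale (B s u0)^-1 s)))
                = vscale a^-1 s by rewrite yZ ?inKV // ys /= mulr0.
    move=> t; rewrite /vadd /vscale /=; congr (_, _).
      by apply: (char2_eq (z := s.1)); field; rewrite a0 Bs.
    by apply: (char2_eq (z := s.2)); field; rewrite a0 Bs.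
  (* Now [u0] is orthogonal to the plane of [v] and [s], which is its own orthogonal, so [y u0] lies
     in [L u0]. It is not in [K u0], as [v] is not, so its trace can be inverted, and [z] is found
     as a preimage of some [(0, m)] with [m] in [K]. *)
  have By t : B (y u0) (t, 0) = tr ((y u0).2 * t).
    by rewrite {1}[y u0]surjective_pairing Bform_coordE mulr0 tr0 add0r.
  have Ky2 : inK (y u0).2.
    by rewrite -tr_eq0 -[_.2]mulr1 -By -yv yB yv Bp.
  have y2 : (y u0).2 = 0.
    have := By c; rewrite trZ // trc mulr1 => <-.
    by rewrite -ys yB BformC.
  have try0 : tr (y u0).1 != 0.
    rewrite tr_eq0; apply: contraFN vE => Ky1.
    have yE : y u0 = vscale (y u0).1 u0.
      by rewrite {1}[y u0]surjective_pairing y2 /vscale /= mulr1 mulr0.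
    have y10 : (y u0).1 != 0.
      apply/eqP => y10; have: y u0 = y (0, 0).
        rewrite (Sp4_map0 (h := y)); last exact/Sp4_setP.
        by rewrite [LHS]surjective_pairing y2 y10.
      by move/perm_inj=> [/eqP]; rewrite oner_eq0.
    have -> : v = vscale (y u0).1^-1 u0.
      apply: (can_inj (permK y)); rewrite yv yZ ?inKV // yE /vscale /=.
      by rewrite mulr1 !mulr0 mulVf.
    by rewrite /vscale /= mulr0 mulr1 eqxx inKV.
  set m := (tr (y u0).1)^-1.
  have Km : inK m by rewrite inKV ?inK_tr.
  have yz : y ((y^-1)%g (0, m)) = (0, m) by rewrite permKV.
  exists ((y^-1)%g (0, m)).
    by rewrite -yB yz [y u0]surjective_pairing y2 Bform_coordE mul0r tr0 addr0 mulrC trZ // mulVf.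
  split; first by rewrite -yB yz yv Bform_coordE mul1r mulr0 tr0 addr0 tr_K.
  have Ka1 : inK (a + 1) := inKD Ka inK1.
  rewrite !yD Bs mulr0 (yZ _ _ inK0) (yZ _ _ (inKM Ka1 (inK_Bform _ _))) ys /= y2.
  by ring.
have [x Sx xE] := Sp4_map_perm (hyperbolic_dilation Ka a0 Bu0z).
have xu : x u0 = (a, 0).
  rewrite xE Bu0z Bc0 /vadd /vscale /=; congr (_, _); last by ring.
  by apply: (char2_eq (z := 1)); ring.
have xyu : (x ^ y)%g u0 = (1, 0).
  rewrite conj_permE -/v xE Bvz (BformC v) Bp -[RHS]yv; congr (y _).
  by rewrite [RHS]surjective_pairing /vadd /vscale /=; congr (_, _); ring.
exists x; split; last by rewrite xu xyu.
  apply: (mem_flag_group trc Sx Ka xu).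
  by rewrite xE Bc0 /vadd /vscale /=; ring.
apply: (mem_flag_group trc (SGJ _ Sx) inK1 xyu).
by rewrite conj_permE -/s xE.
Qed.

(** * Double cosets of the Borel subgroup, and mixed double cosets *)

(** The twists of [y^-1] and [y] by [sigma] cancel, as [sigma] has square 1. *)
Lemma Sp2_conj_MG (x y : {perm vec}) :
  x \in Sp2_set L -> y \in MG L e -> (x ^ y)%g \in Sp2_set L.
Proof.
move=> /Sp2_setP[xD xZ xB] /MG_semilinear[sigma sE [yD yZ yB]].
have sK a : sigma (sigma a) = a by case: sE => sE; rewrite !sE ?frobK.
have yVD u v : (y^-1)%g (vadd u v) = vadd ((y^-1)%g u) ((y^-1)%g v).
  by apply: (@perm_inj _ y); rewrite yD !permKV.
have yVZ a u : (y^-1)%g (vscale a u) = vscale (sigma a) ((y^-1)%g u).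
  by apply: (@perm_inj _ y); rewrite yZ !permKV sK.
apply/Sp2_setP; split=> *; rewrite !conj_permE.
- by rewrite yVD xD yD.
- by rewrite yVZ xZ yZ sK.
by rewrite yB xB -yB !permKV.
Qed.

Lemma exists_frob_neq : exists2 g : L, g != 0 & g ^+ q != g.
Proof.
have [c trc] := exists_tr1.
have cK : ~~ inK c by rewrite -tr_eq0 trc oner_eq0.
by exists c => //; apply: contra cK => /eqP->; apply: inK0.
Qed.

(** If [y] moves the line [L u0], a torus element with eigenvalues [a] and [a^-1] on the two lines
    separates the characters. If [y] fixes the line but is Frobenius-semilinear, a diagonal element
    with [a] outside [K] does, [a] becoming [a ^+ q]. *)
Lemma borel_dichotomy (y : {perm vec}) : y \in MG L e ->
  (exists x, [/\ x \in borel_group, (x ^ y)%g \in borel_group & (x u0).1 != ((x ^ y)%g u0).1])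
  \/ y \in borel_group.
Proof.
move=> My; have [sigma sE [yD yZ yB]] := MG_semilinear My.
have s0 : sigma 0 = 0 by case: sE => sE; rewrite sE ?frob0.
have ut_mem (g : {perm vec}) a k : g \in Sp2_set L ->
    g =1 (fun u => (a * u.1 + k * u.2, a^-1 * u.2)) -> g \in borel_group.
  move=> Sg gE; apply/borel_setP; split; first exact/Sp2_setP.
  by exists a; rewrite gE /= !mulr0 mulr1 addr0.
set v := (y^-1)%g u0; have yv : y v = u0 by rewrite permKV.
have conj_mem x b : x \in Sp2_set L -> x v = vscale b v ->
    (x ^ y)%g u0 = (sigma b, 0) /\ (x ^ y)%g \in borel_group.
  move=> Sx xv; have xyu : (x ^ y)%g u0 = (sigma b, 0).
    by rewrite conj_permE -/v xv yZ yv /vscale /= mulr1 mulr0.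
  by split=> //; apply/borel_setP; split; [apply/Sp2_setP/Sp2_conj_MG | exists (sigma b)].
have [v2|v2] := eqVneq v.2 0; last first.
  have [a Ka /andP[a0 a1]] := exists_inK_neq01.
  (* Chosen to make [v] an eigenvector for [a^-1]. *)
  pose k := (a^-1 + a) * v.1 / v.2.
  have [x Sx xE] := Sp2_map_perm (upper_triangular k a0).
  have [|xyu Bxy] := conj_mem x a^-1 Sx.
    rewrite xE /vscale; congr (_, _); rewrite /k.
    by apply: (char2_eq (z := a * v.1)); field; rewrite ?v2 ?a0.
  left; exists x; split=> //; first exact: ut_mem Sx xE.
  rewrite xyu xE /= mulr1 mulr0 addr0.
  have -> : sigma a^-1 = a^-1 by case: sE => ->; rewrite ?(eqP (inKV Ka)).
  exact: neq_invr.
have vE : v = vscale v.1 u0 by rewrite {1}[v]surjective_pairing v2 /vscale /= mulr1 mulr0.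
have yu : vscale (sigma v.1) (y u0) = u0 by rewrite -yZ -vE yv.
have yu2 : (y u0).2 = 0.
  case: yu => yu1 /eqP; rewrite mulf_eq0 => /orP[/eqP sv0 | /eqP //].
  by move/eqP: yu1; rewrite sv0 mul0r eq_sym oner_eq0.
case: sE => sE.
  right; apply/borel_setP; split; last first.
    by exists (y u0).1; rewrite {1}[y u0]surjective_pairing yu2.
  by split=> *; rewrite ?yD ?yZ ?yB ?sE.
left; have [a a0 aF] := exists_frob_neq.
have [x Sx xE] := Sp2_map_perm (upper_triangular 0 a0).
have [|xyu Bxy] := conj_mem x a Sx.
  by rewrite xE /vscale v2 !mulr0 addr0.
exists x; split=> //; first exact: ut_mem Sx xE.
by rewrite xyu xE /= mulr1 mulr0 addr0 sE eq_sym.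
Qed.

(** The transvection [w] fixes [u0], since [B u0 (c, 1)] is [tr 1 = 0], so conjugation by it keeps
    the eigenvalue on [u0]. *)
Lemma borel_flag_swap (c : L) (w x : {perm vec}) :
    tr c = 1 -> (forall u, w u = vadd u (vscale (B u (c, 1)) (c, 1))) ->
    x \in borel_group -> (x ^ w)%g \in flag_group ->
  (x u0).1 = ((x ^ w)%g u0).1.
Proof.
move=> trc wE /borel_scale[a _ xE] /flag_setP[_ [b Kb xwu] _].
have wK k : inK k -> w (k, 0) = (k, 0).
  move=> Kk; rewrite wE Bform_coordE mulr1 mul0r tr0 (tr_K Kk) /vadd /vscale /=.
  by congr (_, _); ring.
have wVu : (w^-1)%g u0 = u0 by apply: (canLR (permK w)); rewrite wK ?inK1.
suff: (a, 0) = (b, 0) :> vec by rewrite xwu xE mulr1 => -[].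
apply: (@perm_inj _ w); rewrite (wK b Kb) -xwu conj_permE wVu xE mulr1 //.
Qed.

(* [y] sends the flag spanned by [(0, 1)] and [(1, c)] to the one fixed by
   [flag_group]; its stabilizer in [borel_group] is trivial. *)
Lemma borel_flag_generic (c : L) (y x : {perm vec}) :
    tr c = 1 -> y \in Sp4_set L e ->
    y (0, 1) = u0 -> y (1, c) = (c, 0) -> y (0, c) = (0, 1) ->
    x \in borel_group -> (x ^ y)%g \in flag_group ->
  (x u0).1 = ((x ^ y)%g u0).1.
Proof.
move=> trc Sy y01 y1c y0c Bx /flag_setP[_ [b Kb xyu] xy2].
have [yD yZ _] := Sp4_setP _ Sy; have /borel_setP[[xD xZ xB] _] := Bx.
have [a a0 xa] := borel_scale Bx.
have x01 : x (0, 1) = (0, b).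
  apply: (@perm_inj _ y); transitivity (vscale b u0).
    by rewrite -[(0, 1)](permK y) y01 -conj_permE xyu /vscale /= mulr1 mulr0.
  by rewrite -y01 -yZ // /vscale /= mulr1 mulr0.
have ab : a * b = 1.
  by have := xB u0 (0, 1); rewrite xa x01 /beta /= !mulr1 mul0r !subr0.
(* The [(0, c)] part is what [y] sends out of [L u0], so its coefficient [a + b] must vanish. *)
have x1c : x (1, c) = vadd (vscale a (1, c)) (vscale (a + b) (0, c)).
  have -> : (1, c) = vadd u0 (vscale c (0, 1)).
    by rewrite /vadd /vscale /= mulr0 mulr1 addr0 add0r.
  rewrite xD xZ xa x01 /vadd /vscale /=; congr (_, _); first by ring.
  by apply: (char2_eq (z := - (a * c))); ring.
have Ka : inK a.
  by rewrite -(mulr1 a) -(divff (_ : b != 0)) ?mulrA ?ab ?mul1r ?inKV //;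
    apply: contra_eq_neq ab => ->; rewrite mulr0 eq_sym oner_neq0.
have := xy2 c; rewrite conj_permE -y1c permK x1c yD !yZ ?inKD // y1c y0c /= mulr0 add0r mulr1.
move/eqP; rewrite addr_eq0 (oppr_pchar2 pchar2) => /eqP eq_ab.
by rewrite xa xyu mulr1.
Qed.

(** * The three inner products and the contradiction *)

Lemma not_strong_Gelfand_SpG_MG : ~ strong_Gelfand (SpG L e) (MG L e).
Proof.
move=> SG.
have [c trc] := exists_tr1.
have [w Sw wE0] := Sp4_map_perm (transvection (c, 1) inK1).
have {}wE u : w u = vadd u (vscale (B u (c, 1)) (c, 1)) by rewrite wE0 mul1r.
have [n Sn nE] := Sp2_map_perm (upper_triangular c (oner_neq0 L)).
have [j Sj jE] := Sp2_map_perm coordinate_swap.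
have SGM := groupM (G := Group Sp4_group_set).
(* [j * n] carries the flag of [(0, 1)] and [(1, c)] to [K u0 < K^2], which [w] carries to
   [K u0 < L u0]. *)
pose y := (j * n * w)%g.
have Sy : y \in Sp4_set L e by rewrite !SGM // (subsetP Sp2_sub_Sp4).
have w10 : w u0 = u0.
  rewrite wE Bform_coordE mulr1 mul0r tr0 (tr_K inK1) /vadd /vscale /=.
  by congr (_, _); ring.
have w01 : w (0, 1) = (c, 0).
  rewrite wE Bform_coordE mul0r mul1r tr0 trc /vadd /vscale /=; congr (_, _); first by ring.
  by apply: (char2_eq (z := 1)); ring.
have wc0 : w (c, 0) = (0, 1).
  rewrite wE Bform_coordE mulr1 mul0r tr0 trc /vadd /vscale /=; congr (_, _); last by ring.
  by apply: (char2_eq (z := c)); ring.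
have yE u : y u = w (u.2 + c * u.1, u.1) by rewrite !permM jE nE /= invr1 !mul1r.
have y01 : y (0, 1) = u0 by rewrite yE /= mulr0 addr0.
have y1c : y (1, c) = (c, 0) by rewrite yE /= mulr1 (addrr_pchar2 pchar2).
have y0c : y (0, c) = (0, 1) by rewrite yE /= mulr0 addr0.
clearbody y.
have [mu [mu1 muM mu_inj]] := finField_faithful_mul_char L.
pose f (g : {perm vec}) := mu (g u0).1.
have f1 : f 1%g = 1 by rewrite /f perm1.
have flagM : {in flag_group &, {morph f : g h / (g * h)%g >-> g * h}}.
  move=> g h /flag_setP[_ [a Ka gu] _] /flag_setP[Sh _ _].
  by rewrite /f permM gu Sp4_map_scale_u0 // muM.
have borelM : {in borel_group &, {morph f : g h / (g * h)%g >-> g * h}}.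
  move=> g h /borel_setP[_ [a gu]] /borel_setP[Sh _].
  by rewrite /f permM gu Sp2_map_scale_u0 // muM.
have [alpha lin_a aE] := lin_char_of_fun f1 flagM.
have [beta lin_b bE] := lin_char_of_fun f1 borelM.
have sBG := subset_trans borel_sub_MG MG_sub_SpG.
have theta_norm : '['Ind[SpG L e] alpha] <= 2%:R.
  apply: (cfdot_Ind_Ind_le flag_sub_SpG flag_sub_SpG lin_a lin_a (ys := [:: 1; w]%g)).
    by rewrite /= group1 SpGE Sw.
  move=> z; rewrite SpGE => Sz.
  case: (flag_dichotomy trc Sw wE Sz) => [[x [Fx Fxz neq]] | Dz]; [left | right].
    by exists x; split=> //; rewrite !aE // (inj_eq mu_inj).
  apply/hasP; case: Dz => [Fz | [b [d [Fb Fd ->]]]].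
    by exists 1%g; rewrite ?mem_head //; apply/double_cosetE; exists z, 1%g; rewrite !mulg1.
  exists w; first by rewrite !inE eqxx orbT.
  by apply/double_cosetE; exists b, d.
have psi_norm : '['Ind[MG L e] beta] <= 1%:R.
  apply: (cfdot_Ind_Ind_le borel_sub_MG borel_sub_MG lin_b lin_b (ys := [:: 1%g])).
    by rewrite /= group1.
  move=> z Mz; case: (borel_dichotomy Mz) => [[x [Bx Bxz neq]] | Bz]; [left | right].
    by exists x; split=> //; rewrite !bE // (inj_eq mu_inj).
  apply/hasP; exists 1%g; rewrite ?mem_head //.
  by apply/double_cosetE; exists z, 1%g; rewrite !mulg1.
have mixed : 3%:R <= '['Ind[SpG L e] beta, 'Ind[SpG L e] alpha].
  apply: (cfdot_Ind_Ind_ge sBG flag_sub_SpG lin_b lin_a (ys := [:: 1; w; y]%g)).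
  - by rewrite /= group1 !SpGE Sw Sy.
  (* When [z] fixes [u0], an element of this double coset sends some [L]-multiple of [u0] into
     [K u0], whereas [y] sends [K (0, 1)] there. *)
  - have y_notin (z : {perm vec}) : z u0 = u0 -> y \notin (borel_group :* z * flag_group)%g.
      move=> zu; apply/negP => /double_cosetE[x [b [Bx Fb yzE]]].
      have [a a0 xE] := borel_scale Bx; have /flag_setP[_ [k Kk bu] _] := Fb.
      have: y (a^-1, 0) = y (0, k).
        rewrite {1}yzE !permM xE divff // zu bu.
        have /Sp4_setP[_ yZ _] := Sy.
        have -> : (0, k) = vscale k (0, 1) by rewrite /vscale /= mulr0 mulr1.
        by rewrite yZ // y01 /vscale /= mulr1 mulr0.
      by move/perm_inj=> [/eqP]; rewrite invr_eq0 (negPf a0).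
    (* Products of elements of the two groups preserve [L u0], but [w] sends [(c, 0)] to
       [(0, 1)]. *)
    have w_notin : w \notin (borel_group :* 1 * flag_group)%g.
      apply/negP => /double_cosetE[x [b [Bx Fb wzE]]].
      have [a a0 xE] := borel_scale Bx; have /flag_setP[_ _ b2] := Fb.
      have := congr1 snd wc0; rewrite wzE mulg1 permM xE b2 /= => /eqP.
      by rewrite eq_sym oner_eq0.
    by apply/and4P; split=> //; [apply/and3P | apply/andP]; split=> //;
      apply: y_notin; rewrite ?perm1.
  move=> z; rewrite !inE => /or3P[] /eqP-> x Bx Fx; rewrite bE // aE //; congr (mu _).
  - by rewrite conjg1.
  - exact: borel_flag_swap trc wE Bx Fx.
  exact: borel_flag_generic trc Sy y01 y1c y0c Bx Fx.
have Npsi : 'Ind[MG L e] beta \is a character by rewrite cfInd_char ?lin_charW.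
have Ntheta : 'Ind[SpG L e] alpha \is a character by rewrite cfInd_char ?lin_charW.
have := strong_Gelfand_cfdot_Ind_le SG Npsi Ntheta.
rewrite cfIndInd ?MG_sub_SpG ?borel_sub_MG // => le_mixed.
have := le_trans mixed (le_trans le_mixed (ler_pM (cfnorm_ge0 _) (cfnorm_ge0 _) psi_norm theta_norm)).
by rewrite -natrM ler_nat.
Qed.
End QuadraticExtension.

Theorem theorem5p1 (e : nat) (L : finFieldType) :
  (1 < e)%N -> #|L| = (2 ^ (2 * e))%N -> ~ strong_Gelfand (SpG L e) (MG L e).
Proof. exact: not_strong_Gelfand_SpG_MG. Qed.
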